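(* Let $D$ be a finite oriented graph whose missing graph is $S_x\cup S_y$, where $S_x$ and $S_y$ are stars with distinct centers $x\neq y$ (the two stars may be vertex-disjoint or may share vertices). Then $D$ has a vertex $v$ with $|N^+(v)|\le |N^{++}(v)|$.
   Context: An oriented graph is a finite digraph with no loops and at most one arc between any two vertices. $N^+(v)$ is the out-neighborhood of $v$, and the second out-neighborhood $N^{++}(v)$ is the set of vertices $w\notin N^+(v)\cup\{v\}$ such that $u\to w$ for some $u\in N^+(v)$. Two distinct vertices $u,v$ form a missing edge $uv$ if neither $(u,v)$ nor $(v,u)$ is an arc. The missing graph of $D$ is the graph whose edges are the missing edges of $D$ and whose vertices are the vertices incident to a missing edge. A star $S_x$ with center $x$ and leaves $a_1,\dots,a_k$ ($k\ge 0$) is the graph with vertex set $\{x,a_1,\dots,a_k\}$ and edges $a_ix$. *)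

(* Defs.v *)
From mathcomp Require Import all_boot.
Set Implicit Arguments. Unset Strict Implicit. Unset Printing Implicit Defensive.

Section Digraphs.
Variable V : finType.
Variable arc : rel V.

Definition oriented : Prop :=
  (forall v, ~~ arc v v) /\ (forall u v, arc u v -> ~~ arc v u).

Definition out_nbhd (v : V) : {set V} := [set w | arc v w].

Definition second_out_nbhd (v : V) : {set V} :=
  [set w | [&& w \notin out_nbhd v, w != v & [exists u, arc v u && arc u w]]].

Definition missing (u v : V) : bool := [&& u != v, ~~ arc u v & ~~ arc v u].

Definition missing_vertices : {set V} := [set u | [exists v, missing u v]].
End Digraphs.

(* star S_x with center x and leaf set L (x \notin L): edges a x, a in L *)
Definition star_edge (V : finType) (x : V) (L : {set V}) (u v : V) : bool :=
  ((u == x) && (v \in L)) || ((v == x) && (u \in L)).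

Definition star_vertices (V : finType) (x : V) (L : {set V}) : {set V} :=
  x |: L.

(* Main.v *)
Require Import Defs.
From mathcomp Require Import all_boot zify.

Set Implicit Arguments. Unset Strict Implicit. Unset Printing Implicit Defensive.

(** Complete D to a semicomplete digraph T: a missing edge receives the
    direction u -> w whenever [convenient], i.e. whenever it brings no new
    second out-neighbour to an in-neighbour of u; if neither direction is
    convenient, the edge points to a centre.  Take an order of the vertices
    maximising the weight of forward T-arcs, and let f be its last vertex.  By
    the argument of Havet and Thomassé, the weight of N^+(f) is at most that of
    the vertices reached from f by an arc of D followed by an arc of T.  The
    latter all lie in N^++(f), except possibly centres.  If a centre is such an
    exception, then the other centre is neither an exception nor in N^+(f).
    Giving the centres weight 2 and all other vertices weight 3 therefore
    leaves an error of at most 2 in 3|N^+(f)| <= 3|N^++(f)| + 2. *)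

Lemma leq_sum_sub_seq (I : eqType) (w : I -> nat) (P Q : pred I) (s : seq I) :
  {in s, forall i, P i -> Q i} ->
  \sum_(i <- s | P i) w i <= \sum_(i <- s | Q i) w i.
Proof.
move=> sPQ; rewrite big_seq_cond [leqRHS]big_seq_cond big_mkcond [leqRHS]big_mkcond.
apply: leq_sum => i _; case: (boolP (i \in s)) => //= si.
by case: ifP => // /(sPQ i si) ->.
Qed.

(** * Weighted median orders *)

Section MedianOrder.
Variables (V : finType) (T : rel V) (w : V -> nat).

Fixpoint forward_weight (s : seq V) : nat :=
  if s is v :: s' then w v * (\sum_(u <- s' | T v u) w u) + forward_weight s'
  else 0.

Definition cross_weight (s1 s2 : seq V) : nat :=
  \sum_(v <- s1) w v * (\sum_(u <- s2 | T v u) w u).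

Lemma forward_weight_cat s1 s2 :
  forward_weight (s1 ++ s2) =
  forward_weight s1 + forward_weight s2 + cross_weight s1 s2.
Proof.
rewrite /cross_weight; elim: s1 => [|v s1 IH] /=; first by rewrite big_nil addn0.
rewrite IH big_cat big_cons /=; lia.
Qed.

Lemma cross_weight_perm s1 s2 s3 :
  perm_eq s2 s3 -> cross_weight s1 s2 = cross_weight s1 s3.
Proof. by move=> h; apply: eq_bigr => v _; rewrite (perm_big _ h). Qed.

Lemma cross_weight_consr s1 v s2 :
  cross_weight s1 (v :: s2) =
  w v * (\sum_(u <- s1 | T u v) w u) + cross_weight s1 s2.
Proof.
rewrite /cross_weight big_distrr /= (big_mkcond (fun u => T u v)) -big_split /=.
by apply: eq_bigr => u _; rewrite big_cons; case: (T u v); lia.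
Qed.

(** The half of the feedback property of median orders that concerns intervals ending just before
    [v]. *)
Definition feedback (s : seq V) : Prop :=
  forall p q v r, s = p ++ q ++ v :: r ->
  \sum_(u <- q | T v u) w u <= \sum_(u <- q | T u v) w u.

Lemma feedback_suffix p s : feedback (p ++ s) -> feedback s.
Proof. by move=> h p' q v r Es; apply: (h (p ++ p') q v r); rewrite Es catA. Qed.

(** In an order of maximal forward weight, moving [v] in front of [q] changes the weight by [w v]
    times the difference of the two sums; maximality bounds it, and [w v] cancels. *)
Lemma median_order_exists :
  (forall v, 0 < w v) -> exists2 s, perm_eq s (enum V) & feedback s.
Proof.
move=> w_gt0; have h0 : perm_eq (in_tuple (enum V)) (enum V) by [].
have [s hs smax] := @arg_maxnP _ (in_tuple (enum V))
  (fun t : (size (enum V)).-tuple V => perm_eq t (enum V)) forward_weight h0.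
move: hs => /= hs; exists s => // p q v r Es.
have hCA : perm_eq (v :: q ++ r) (q ++ v :: r)
  by rewrite (permEl (perm_catCA [:: v] q r)).
have hp : perm_eq (p ++ v :: q ++ r) (enum V).
  by apply: perm_trans hs; rewrite /= Es perm_cat2l.
have szp : size (p ++ v :: q ++ r) == size (enum V) by rewrite (perm_size hp).
have := smax (Tuple szp) hp; rewrite /= Es !forward_weight_cat /=.
rewrite (cross_weight_consr q) forward_weight_cat big_cat /=.
rewrite (cross_weight_perm p hCA).
by move=> le; rewrite -(leq_pmul2l (w_gt0 v)); lia.
Qed.

(* In the induction, cut [s] at its first vertex [v] outside both [P] and [Q]:
   to its left, the out-neighbours of [v] include [P] and its in-neighbours
   avoid [P], so that the feedback property at [v] settles this part. *)
Lemma feedback_le (P Q : pred V) (s : seq V) :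
  (forall u v, u != v -> T u v || T v u) ->
  uniq s -> feedback s ->
  (forall p q, s = p ++ q ->
     \sum_(u <- q | P u) w u <= \sum_(u <- q | ~~ P u) w u) ->
  (forall u v, u \in s -> v \in s -> P u -> ~~ P v -> T u v -> Q v) ->
  \sum_(u <- s | P u) w u <= \sum_(u <- s | Q u) w u.
Proof.
move=> Ttot; have [n] := ubnP (size s); elim: n s => // n IH s /ltnSE les us fb fP hQ.
have sumQ q : {in q, forall u, P u || Q u} ->
    \sum_(u <- q | ~~ P u) w u <= \sum_(u <- q | Q u) w u.
  by move=> hq; apply: leq_sum_sub_seq => u /hq; case: (P u).
have [bad|nbad] := boolP (has (fun v => ~~ P v && ~~ Q v) s); last first.
  apply: leq_trans (fP [::] s erefl) (sumQ _ _) => u us'.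
  by have /hasPn/(_ u us') := nbad; case: (P u); case: (Q u).
move: les us fb fP hQ; case: (split_find bad) => v q r /andP[nPv nQv] nq.
rewrite cat_rcons => les us fb fP hQ; rewrite !big_cat !big_cons /= (negbTE nPv) (negbTE nQv).
have Eqr : q ++ v :: r = (q ++ [:: v]) ++ r by rewrite -catA.
apply: leq_add; last first.
  apply: IH.
  - by move: les; rewrite size_cat /=; lia.
  - by move: us; rewrite cat_uniq /= => /and3P[_ _ /andP[]].
  - by apply: (@feedback_suffix (q ++ [:: v])); rewrite -Eqr.
  - by move=> p q' Er; apply: (fP (q ++ v :: p)); rewrite Er -catA.
  - by move=> u u' ur u'r; apply: hQ; rewrite mem_cat inE ?ur ?u'r !orbT.
have nT u : u \in q -> P u -> ~~ T u v.
  move=> uq Pu; apply: contra nQv; apply: (hQ u) => //; rewrite mem_cat ?uq //.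
  by rewrite inE eqxx orbT.
apply: leq_trans (sumQ q _); last first.
  by move=> u uq; have /hasPn/(_ u uq) := nq; case: (P u); case: (Q u).
apply: (@leq_trans (\sum_(u <- q | T v u) w u)).
  apply: leq_sum_sub_seq => u uq Pu.
  have neq : u != v by apply: contraTneq Pu => ->.
  by have := Ttot u v neq; rewrite (negbTE (nT u uq Pu)).
apply: leq_trans (fb [::] q v r erefl) _.
by apply: leq_sum_sub_seq => u uq; apply: contraTN; apply: nT.
Qed.

End MedianOrder.

(** * Completing the missing edges, and the vertices lost *)

Section TwoStars.
Variables (V : finType) (arc : rel V) (x y : V) (Lx Ly : {set V}).
Hypothesis orD : oriented arc.
Hypothesis neq_xy : x != y.
Hypothesis missE :
  forall u v, missing arc u v = star_edge x Lx u v || star_edge y Ly u v.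

Let N2 v := out_nbhd arc v :|: second_out_nbhd arc v.

Lemma mem_N2 u v w : arc u v -> arc v w -> w != u -> w \in N2 u.
Proof.
move=> uv vw wu; rewrite !inE wu /=; case: (arc u w) => //=.
by apply/existsP; exists v; rewrite uv.
Qed.

Definition convenient u w := [forall v, arc v u ==> (w \in N2 v)].

Definition completion u w :=
  arc u w || missing arc u w &&
    (convenient u w || (w \in [set x; y]) && ~~ convenient w u).

Definition reached f :=
  [set z | [&& ~~ arc f z, z != f & [exists u, arc f u && completion u z]]].

Definition lost f := reached f :\: second_out_nbhd arc f.

Lemma arc_irr v : arc v v = false.
Proof. by have [/(_ v)/negbTE] := orD. Qed.

Lemma arc_asym u v : arc u v -> arc v u = false.
Proof. by have [_ h] := orD => /h/negbTE. Qed.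

Lemma missingC u v : missing arc u v = missing arc v u.
Proof. by rewrite /missing eq_sym; case: (arc u v); case: (arc v u). Qed.

Lemma missing_center u v : missing arc u v -> (u \in [set x; y]) || (v \in [set x; y]).
Proof. by rewrite missE !inE => /orP[] /orP[] /andP[/eqP-> _]; rewrite eqxx ?orbT. Qed.

Lemma completion_total u v : u != v -> completion u v || completion v u.
Proof.
move=> uv; rewrite /completion (missingC v u).
case: (boolP (arc u v)) => //= nuv; case: (boolP (arc v u)) => /= nvu; first by rewrite orbT.
have m : missing arc u v by rewrite /missing uv nuv nvu.
rewrite m /=; case: (convenient u v) => //=; case: (convenient v u); rewrite /= ?orbT //.
by rewrite !andbT; have := missing_center m; rewrite orbC.
Qed.

(** Say [z] is reached through [a]. The arc [f -> a] shows that [a -> z] is not convenient, so [z]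
    is a centre and [z -> a] is not convenient either: some [u -> z] has [a] outside [N2 u]. Then
    [f -> u] would put [z] in [N2 f], and [u -> f] would put [a] in [N2 u]. *)
Lemma lost_witness f z : z \in lost f ->
  [/\ z \in [set x; y], ~~ arc f z, z != f &
      exists2 u, arc u z & missing arc f u].
Proof.
rewrite !inE => /andP[nS /and3P[nfz zf /existsP[a /andP[fa]]]].
have nN2 : z \notin N2 f by rewrite !inE negb_or nS nfz.
case/orP => [az|/andP[maz]]; first by rewrite (mem_N2 fa az zf) in nN2.
case/orP => [/forallP/(_ f)|/andP[zxy /forallPn[u]]].
  by rewrite fa /= (negbTE nN2).
rewrite negb_imply => /andP[uz naN]; split => //; first by rewrite !inE in zxy.
exists u => //; have neq_au : a != u.
  by apply: contraTneq maz => ->; rewrite /missing uz andbF.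
apply/and3P; split.
- by apply: contraNneq nfz => ->.
- by apply: contra nN2 => fu; apply: mem_N2 fu uz zf.
- by apply: contra naN => uf; apply: mem_N2 uf fa neq_au.
Qed.

Lemma lost_sub f : lost f \subset [set x; y].
Proof. by apply/subsetP => z /lost_witness[]. Qed.

(** The missing edge [f u] given by [lost_witness] avoids [x], so it belongs to the star at [y]. *)
Lemma lostx f : x \in lost f -> f = y \/ arc y x /\ missing arc f y.
Proof.
case/lost_witness => _ _ xf [u ux m]; move: (m); rewrite missE.
have neq_ux : u != x by apply: contraTneq ux => ->; rewrite arc_irr.
rewrite /star_edge eq_sym (negbTE xf) (negbTE neq_ux) /=.
by case/orP => /andP[/eqP Ey _]; [left | right; rewrite -Ey].
Qed.

Lemma losty f : y \in lost f -> f = x \/ arc x y /\ missing arc f x.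
Proof.
case/lost_witness => _ _ yf [u uy m]; move: (m); rewrite missE.
have neq_uy : u != y by apply: contraTneq uy => ->; rewrite arc_irr.
rewrite /star_edge [f == y]eq_sym (negbTE yf) (negbTE neq_uy) /= orbF.
by case/orP => /andP[/eqP Ex _]; [left | right; rewrite -Ex].
Qed.

(** As [f] is neither centre, both [y -> x] and [x -> y] would be arcs. *)
Lemma lost_both f : x \in lost f -> y \notin lost f.
Proof.
move=> lx; apply/negP => ly.
have [_ _ xf _] := lost_witness lx; have [_ _ yf _] := lost_witness ly.
case: (lostx lx) => [fy|[yx _]]; first by rewrite fy eqxx in yf.
case: (losty ly) => [fx|[xy _]]; first by rewrite fx eqxx in xf.
by rewrite (arc_asym xy) in yx.
Qed.

Lemma lostx_arc f : x \in lost f -> ~~ arc f x && ~~ arc f y.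
Proof.
move=> lx; have [_ -> _ _] := lost_witness lx.
by case: (lostx lx) => [->|[_ /and3P[]//]]; rewrite arc_irr.
Qed.

Lemma losty_arc f : y \in lost f -> ~~ arc f x && ~~ arc f y.
Proof.
move=> ly; have [_ -> _ _] := lost_witness ly; rewrite andbT.
by case: (losty ly) => [->|[_ /and3P[]//]]; rewrite arc_irr.
Qed.

(** * Weighted counting *)

Definition weight (v : V) := 3 - (v == x) - (v == y).

Lemma weight_sum (A : {set V}) :
  \sum_(v in A) weight v + (x \in A) + (y \in A) = 3 * #|A|.
Proof.
have sum1 z : (z \in A : nat) = \sum_(v in A) (v == z).
  rewrite big_mkcond (bigD1 z) //= eqxx big1 => [|v /negbTE->]; last by case: ifP.
  by case: (z \in A).
rewrite !sum1 -!big_split /= mulnC -sum_nat_const; apply: eq_bigr => v _.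
rewrite /weight; case: (v =P x) => [->|_] /=; first by rewrite (negbTE neq_xy).
by case: (v == y).
Qed.

Lemma reached_weight :
  exists f, \sum_(v in out_nbhd arc f) weight v <= \sum_(v in reached f) weight v.
Proof.
have w_gt0 v : 0 < weight v by rewrite /weight; case: (v == x); case: (v == y).
have [s sV] := median_order_exists completion w_gt0.
case/lastP: s sV => [sV|s f sV fb]; first by have := perm_mem sV x; rewrite mem_enum.
have us : uniq (rcons s f) by rewrite (perm_uniq sV) enum_uniq.
have [fs us'] : f \notin s /\ uniq s by move: us; rewrite rcons_uniq => /andP[].
(* Neither set contains [f], so both sums can be taken over [s]. *)
have sum_s (P : pred V) : ~~ P f -> \sum_(v | P v) weight v = \sum_(v <- s | P v) weight v.
  move=> nPf; have sI : perm_eq (index_enum V) (rcons s f).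
    by rewrite perm_sym (permPl sV) enumT.
  by rewrite (perm_big _ sI) big_rcons (negbTE nPf) /= addn0.
exists f; rewrite !sum_s ?inE ?arc_irr ?eqxx ?andbF //.
apply: feedback_le completion_total us' _ _ _.
- by move=> p q v r Es; apply: (fb p q v (rcons r f)); rewrite Es rcons_cat rcons_cat.
(* Since [f] is last, each suffix of [s] is an interval ending just before [f]. *)
- move=> p q Es; have := fb p q f [::]; rewrite Es -cats1 -catA => /(_ erefl) le.
  have arc_sub : \sum_(u <- q | u \in out_nbhd arc f) weight u <=
                 \sum_(u <- q | completion f u) weight u.
    by apply: leq_sum_sub_seq => u _; rewrite inE /completion => ->.
  apply: leq_trans arc_sub (leq_trans le _); apply: leq_sum_sub_seq => u _.
  by case/orP => [/arc_asym nfu|/andP[/and3P[_ _ /negbTE nfu] _]]; rewrite inE nfu.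
- move=> u v _ vs; rewrite !inE => fu nfv uv; rewrite nfv /=; apply/andP; split.
    by apply: contraNneq fs => <-.
  by apply/existsP; exists u; rewrite fu.
Qed.

Lemma two_stars_snp : exists f, #|out_nbhd arc f| <= #|second_out_nbhd arc f|.
Proof.
have [f] := reached_weight; exists f.
have := weight_sum (out_nbhd arc f); have := weight_sum (reached f).
have lostR z : z \in lost f -> z \in reached f by rewrite inE => /andP[].
have cR : #|reached f| <= #|second_out_nbhd arc f| + #|lost f|.
  by rewrite -(cardsID (second_out_nbhd arc f)) leq_add2r subset_leq_card // subsetIr.
have := weight_sum (lost f).
(* Together with [weight_sum], this bounds [#|lost f|] by the number of lost centres. *)
have : \sum_(v in lost f) weight v <= 2 * ((x \in lost f) + (y \in lost f)).
  rewrite (eq_bigl (fun v => (v \in [set x; y]) && (v \in lost f))); last first.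
    move=> v; case: (boolP (v \in lost f)); rewrite ?andbF ?andbT //.
    by move/(subsetP (lost_sub f)).
  rewrite big_mkcondr big_setU1 /= ?in_set1 // big_set1.
  rewrite /weight !eqxx [y == x]eq_sym (negbTE neq_xy).
  by case: (x \in lost f); case: (y \in lost f).
move: (@lost_both f) (@lostx_arc f) (@losty_arc f) (lostR x) (lostR y).
rewrite ![_ \in out_nbhd _ _]inE.
(* If no centre is lost, the error is the number of centres in [out_nbhd arc f], at most 2. If one
   is lost, that number is 0, and the lost vertex costs 3 but weighs only 2 in [reached f].
   Divisibility by 3 concludes. *)
lia.
Qed.

End TwoStars.

Theorem theorem3p1 (V : finType) (arc : rel V) (x y : V) (Lx Ly : {set V}) :
  oriented arc ->
  x != y ->
  x \notin Lx -> y \notin Ly ->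
  (* the missing graph of D is the graph S_x \cup S_y: same edges ... *)
  (forall u v, missing arc u v = star_edge x Lx u v || star_edge y Ly u v) ->
  (* ... and same vertex set *)
  missing_vertices arc = star_vertices x Lx :|: star_vertices y Ly ->
  exists v : V, #|out_nbhd arc v| <= #|second_out_nbhd arc v|.
Proof.
move=> orD neq_xy _ _ missE _.
exact: two_stars_snp orD neq_xy missE.
Qed.
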